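(* Let $(M,F)$ be a semi-C-reducible Finsler manifold satisfying the SC-condition, i.e. there is a nonzero vector field $B^i(x)$ on $M$ with $B^h(x)\,C_{hij}=0$. Then $(M,F)$ is either Riemannian or $C_2$-like.
   Context: Manifolds are smooth and connected. A Finsler structure on a manifold $M$ of dimension $n$ is a function $F:TM\to\mathbb R$ with $F\ge 0$, $F(0)=0$; $F$ is $C^\infty$ on the slit tangent bundle $TM\setminus\{0\}$; $F(x,\lambda y)=\lambda F(x,y)$ for $\lambda>0$; and $g_{ij}(x,y):=\frac12\frac{\partial^2F^2}{\partial y^i\partial y^j}$ is positive definite at each point of $TM\setminus\{0\}$. The pair $(M,F)$ is then called a Finsler manifold. Notation: $(x^i)$ are coordinates on $M$, $(y^i)$ the induced fibre coordinates, $\dot\partial_i=\partial/\partial y^i$; $(g^{ij})$ is the inverse of $(g_{ij})$; repeated indices are summed. Cartan tensor: $C_{ijk}:=\frac12\dot\partial_kg_{ij}$. $(M,F)$ is Riemannian if $C_{ijk}=0$, equivalently $g_{ij}$ depends on $x$ only. Put $l_i:=\dot\partial_iF$, $h_{ij}:=g_{ij}-l_il_j$, $C_i:=C_{ijk}g^{jk}$, $C^i:=g^{ij}C_j$, $C^2:=C_iC^i$. $(M,F)$, of dimension $n\ge2$, is $C_2$-like if $C_{ijk}=\frac1{C^2}C_iC_jC_k$. $(M,F)$, of dimension $n\ge3$, is semi-C-reducible if $C_{ijk}=\frac{r}{n+1}(h_{ij}C_k+h_{ki}C_j+h_{jk}C_i)+\frac{t}{C^2}C_iC_jC_k$, where $r$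 and $t$ are scalar functions such that $r+t=1$. *)

(* Defs.v *)
From HB Require Import structures.
From mathcomp Require Import all_boot all_order all_algebra.
From mathcomp Require Import all_classical all_reals all_analysis.
Set Implicit Arguments.
Unset Strict Implicit.
Unset Printing Implicit Defensive.
Import Order.TTheory GRing.Theory Num.Theory.
Import numFieldNormedType.Exports.
Local Open Scope classical_set_scope.
Local Open Scope ring_scope.

(* [f] is infinitely differentiable on (the open set) [U]: every iterated
   directional derivative is Frechet differentiable, hence continuous, at each
   point of [U]. *)
Definition smooth_on (R : realType) (V W : normedModType R)
    (U : set V) (f : V -> W) : Prop :=
  forall (vs : seq V) (x : V), U x ->
    differentiable (foldr (fun v g => 'D_v g) f vs) x.

Lemma near_eq_diff (R : realType) (V W : normedModType R) (f g : V -> W)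
    (x y : V) :
  differentiable f x -> differentiable g x -> {near x, f =1 g} ->
  'd f x y = 'd g x y.
Proof.
by move=> df dg fg; rewrite -!deriveE//; exact: near_eq_derive.
Qed.

Lemma near_eq_diff_comp (R : realType) (U V W : normedModType R)
    (f : U -> V) (g : V -> W) (h : U -> W) (x y : U) :
  differentiable f x -> differentiable g (f x) -> differentiable h x ->
  {near x, h =1 g \o f} -> 'd h x y = 'd g (f x) ('d f x y).
Proof.
move=> df dg dh hgf.
have dgf : differentiable (g \o f) x by exact: differentiable_comp.
by rewrite (near_eq_diff y dh dgf hgf) (diff_comp df dg).
Qed.

Lemma near_id_diff (R : realType) (V : normedModType R) (f : V -> V)
    (x y : V) :
  differentiable f x -> {near x, f =1 id} -> 'd f x y = y.
Proof.
move=> df fid; have did : differentiable (@id V) x by [].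
by rewrite (near_eq_diff y df did fid) diff_val.
Qed.

(* [chart_inv] is junk outside [chart_cod]. *)
Record chart (R : realType) (n : nat) (M : topologicalType) := Chart {
  chart_dom : set M;
  chart_map :> M -> 'rV[R]_n;
  chart_inv : 'rV[R]_n -> M;
  chart_dom_open : open chart_dom;
  chart_cod_open : open (chart_map @` chart_dom);
  chart_mapK : {in chart_dom, cancel chart_map chart_inv};
  chart_map_continuous : {in chart_dom, continuous chart_map};
  chart_inv_continuous : {in chart_map @` chart_dom, continuous chart_inv}
}.

Definition chart_cod (R : realType) (n : nat) (M : topologicalType)
  (c : chart R n M) : set 'rV[R]_n := c @` chart_dom c.

Definition transition (R : realType) (n : nat) (M : topologicalType)
  (c d : chart R n M) : 'rV[R]_n -> 'rV[R]_n := d \o chart_inv c.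

(* The smooth structure is given by an atlas, not necessarily maximal. *)
Record manifold (R : realType) (n : nat) := Manifold {
  point_of :> topologicalType;
  manifold_hausdorff : hausdorff_space point_of;
  manifold_countable : @second_countable point_of;
  manifold_connected : connected [set: point_of];
  atlas_index : Type;
  atlas : atlas_index -> chart R n point_of;
  atlas_cover : forall p : point_of, exists a, chart_dom (atlas a) p;
  atlas_smooth : forall a b,
    smooth_on (atlas a @` (chart_dom (atlas a) `&` chart_dom (atlas b)))
              (transition (atlas a) (atlas b))
}.

Section TangentBundle.
Variables (R : realType) (n : nat) (M : manifold R n).
Implicit Types (p : M) (a b : atlas_index M).

(* A tangent vector at [p] is a family of component vectors, one for each chart
   around [p], obeying the contravariant transformation law; the components in
   the charts whose domain misses [p] are set to 0 by convention. *)
Definition contravariant p : {pred atlas_index M -> 'rV[R]_n} :=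
  fun v => `[<
    (forall a b, chart_dom (atlas a) p -> chart_dom (atlas b) p ->
       v b = 'd (transition (atlas a) (atlas b)) (atlas a p) (v a)) /\
    (forall a, ~ chart_dom (atlas a) p -> v a = 0) >].

Lemma contravariant_submod_closed p : submod_closed (contravariant p).
Proof.
split; first by apply/asboolP; split => [a b _ _|//]; rewrite linear0.
move=> k u v /asboolP[u1 u2] /asboolP[v1 v2]; apply/asboolP; split.
  move=> a b pa pb; rewrite (_ : (k *: u + v) b = k *: u b + v b)//.
  by rewrite (u1 a b)// (v1 a b)// -linearP.
move=> a pa; rewrite (_ : (k *: u + v) a = k *: u a + v a)//.
by rewrite u2// v2// scaler0 addr0.
Qed.

HB.instance Definition _ p :=
  GRing.isSubmodClosed.Build R (atlas_index M -> 'rV[R]_n) (contravariant p)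
    (contravariant_submod_closed p).

Record tangent_space p := TangentVector {
  components :> atlas_index M -> 'rV[R]_n;
  _ : components \in contravariant p
}.

HB.instance Definition _ p := [isSub for @components p].
HB.instance Definition _ p := [Choice of tangent_space p by <:].
HB.instance Definition _ p :=
  [SubChoice_isSubLmodule of tangent_space p by <:].

Definition tangent_bundle := {p : M & tangent_space p}.

Definition tangent p (v : tangent_space p) : tangent_bundle := existT _ p v.

(* The tangent vector y^i d/dx^i at the point of coordinates [x] in chart [a],
   for [x] in the codomain of [a]; see [tangent_of_coordE] and [tangent_inj]. *)
Definition tangent_of_coord a (x y : 'rV[R]_n) :
    tangent_space (chart_inv (atlas a) x) :=
  xget (0 : tangent_space _) [set v | v a = y].

Lemma tangent_inj p a (v w : tangent_space p) :
  chart_dom (atlas a) p -> v a = w a -> v = w.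
Proof.
case: v w => [v vp] [w wp] /= pa vwa; apply/val_inj/funext => b /=.
have /asboolP[v1 v2] := vp; have /asboolP[w1 w2] := wp.
have [pb|pb] := pselect (chart_dom (atlas b) p).
  by rewrite (v1 a b)// (w1 a b)// vwa.
by rewrite v2// w2.
Qed.

Lemma transition_near a b x : chart_cod (atlas a) x ->
  chart_dom (atlas b) (chart_inv (atlas a) x) ->
  \forall z \near x, chart_dom (atlas b) (chart_inv (atlas a) z).
Proof.
move=> xa xb.
apply: (chart_inv_continuous (mem_set xa)).
exact: open_nbhs_nbhs (conj (chart_dom_open (atlas b)) xb).
Qed.

Lemma transition_differentiable a b x : chart_cod (atlas a) x ->
  chart_dom (atlas b) (chart_inv (atlas a) x) ->
  differentiable (transition (atlas a) (atlas b)) x.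
Proof.
move=> [p pa <-]; rewrite chart_mapK ?inE// => pb.
by apply: (@atlas_smooth R n M a b [::]); exists p.
Qed.

Lemma tangent_of_coordE a x y :
  chart_cod (atlas a) x -> tangent_of_coord a x y a = y.
Proof.
move=> xa.
suff [w wa] : exists w : tangent_space (chart_inv (atlas a) x), w a = y.
  by rewrite /tangent_of_coord; case: xgetP => [v _ //|/(_ w)].
have xE : atlas a (chart_inv (atlas a) x) = x.
  by have [p pa <-] := xa; rewrite chart_mapK ?inE.
have pa : chart_dom (atlas a) (chart_inv (atlas a) x).
  by have [p pa <-] := xa; rewrite chart_mapK ?inE.
pose p := chart_inv (atlas a) x.
pose w b := if pselect (chart_dom (atlas b) p)
            then 'd (transition (atlas a) (atlas b)) x y else 0.
have w_contra : w \in contravariant p.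
  apply/asboolP; split => [b c pb pc|b pb]; last by rewrite /w; case: pselect.
  rewrite /w; case: pselect => [?|//]; case: pselect => [?|//].
  have xb : chart_cod (atlas b) (atlas b p) by exists p.
  have dab : differentiable (transition (atlas a) (atlas b)) x.
    exact: transition_differentiable.
  have dbc : differentiable (transition (atlas b) (atlas c))
      (transition (atlas a) (atlas b) x).
    by apply: transition_differentiable => //; rewrite chart_mapK ?inE.
  apply: (near_eq_diff_comp y dab dbc); first exact: transition_differentiable.
  have := transition_near xa pb; apply: filterS => z zb.
  by rewrite /transition/= chart_mapK ?inE.
exists (TangentVector w_contra); rewrite /= /w; case: pselect => [?|//].
apply: near_id_diff; first exact: transition_differentiable.
have : nbhs x (chart_cod (atlas a)).
  by apply: open_nbhs_nbhs; split => //; exact: chart_cod_open.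
by apply: filterS => z [q qa <-]; rewrite /transition/= chart_mapK ?inE.
Qed.

End TangentBundle.

(* Tensors of the Minkowski norm [L], i.e. of F restricted to one tangent space,
   in linear coordinates y^1, ..., y^n. *)
Section MinkowskiNorm.
Variables (R : realType) (n : nat).
Implicit Types (L f : 'rV[R]_n -> R) (y : 'rV[R]_n) (i j k : 'I_n).

Definition vderiv i f : 'rV[R]_n -> R :=
  'D_(delta_mx 0 i) (f : 'rV[R]_n -> R^o).

Definition metric L y : 'M[R]_n :=
  \matrix_(i, j) (2^-1 * vderiv i (vderiv j (fun z => L z ^+ 2)) y).

Definition cartan L y i j k : R := 2^-1 * vderiv k (fun z => metric L z i j) y.

Definition angular_metric L y i j : R :=
  metric L y i j - vderiv i L y * vderiv j L y.

Definition mean_cartan L y i : R :=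
  \sum_j \sum_k cartan L y i j k * invmx (metric L y) j k.

Definition mean_cartan_up L y i : R :=
  \sum_j invmx (metric L y) i j * mean_cartan L y j.

Definition mean_cartan_sq L y : R :=
  \sum_i mean_cartan L y i * mean_cartan_up L y i.

End MinkowskiNorm.

Section Finsler.
Variables (R : realType) (n : nat) (M : manifold R n).
Implicit Types (F : tangent_bundle M -> R) (a : atlas_index M).

Definition in_coord F a (x y : 'rV[R]_n) : R :=
  F (tangent (tangent_of_coord a x y)).

Record finsler_structure F : Prop := FinslerStructure {
  finsler_ge0 : forall p (v : tangent_space p), 0 <= F (tangent v);
  finsler0 : forall p : M, F (tangent (0 : tangent_space p)) = 0;
  finsler_smooth : forall a,
    smooth_on [set xy : 'rV[R]_n * 'rV[R]_n |
                chart_cod (atlas a) xy.1 /\ xy.2 <> 0]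
              (fun xy => in_coord F a xy.1 xy.2 : R^o);
  finsler_homogeneous : forall p (v : tangent_space p) (lambda : R),
    0 < lambda -> F (tangent (lambda *: v)) = lambda * F (tangent v);
  finsler_metric_gt0 : forall a x y, chart_cod (atlas a) x -> y <> 0 ->
    forall u : 'rV[R]_n, u <> 0 ->
    0 < (u *m metric (in_coord F a x) y *m u^T) 0 0
}.

Definition riemannian F : Prop :=
  forall a x y, chart_cod (atlas a) x -> y <> 0 ->
  forall i j k, cartan (in_coord F a x) y i j k = 0.

(* In the next two definitions, x / 0 = 0 makes C_i C_j C_k / C^2 vanish where
   C_i = 0; this is its continuous extension, since its norm is that of C_i. *)
Definition C2_like F : Prop :=
  (2 <= n)%N /\
  forall a x y, chart_cod (atlas a) x -> y <> 0 ->
  let L := in_coord F a x in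
  let C := mean_cartan L y in
  forall i j k,
    cartan L y i j k = 1 / mean_cartan_sq L y * C i * C j * C k.

Definition semi_C_reducible F : Prop :=
  (3 <= n)%N /\
  exists r t : tangent_bundle M -> R,
    (forall p (v : tangent_space p), v <> 0 ->
       r (tangent v) + t (tangent v) = 1) /\
    forall a x y, chart_cod (atlas a) x -> y <> 0 ->
    let L := in_coord F a x in
    let C := mean_cartan L y in
    let h := angular_metric L y in
    forall i j k,
      cartan L y i j k =
        in_coord r a x y / (n + 1)%:R *
          (h i j * C k + h k i * C j + h j k * C i) +
        in_coord t a x y / mean_cartan_sq L y * C i * C j * C k.

Definition smooth_vector_field (B : forall p : M, tangent_space p) : Prop :=
  forall a, smooth_on (chart_cod (atlas a))
                      (fun x => B (chart_inv (atlas a) x) a).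

(* "Nonzero" means nowhere vanishing. *)
Definition SC_condition F : Prop :=
  exists B : forall p : M, tangent_space p,
    [/\ smooth_vector_field B,
        forall p, B p <> 0 &
        forall a x y, chart_cod (atlas a) x -> y <> 0 ->
        forall i j,
          \sum_h B (chart_inv (atlas a) x) a 0 h *
                 cartan (in_coord F a x) y h i j = 0].

End Finsler.

(* Main.v *)
Require Import Defs.
From mathcomp Require Import all_boot all_order all_algebra.
From mathcomp Require Import all_classical all_reals all_analysis.
From mathcomp Require Import ring.
Import Order.TTheory GRing.Theory Num.Theory.
Import numFieldNormedType.Exports.
Local Open Scope classical_set_scope.
Local Open Scope ring_scope.

(** C2-likeness holds, in the convention [1 / 0 = 0] that makes a vanishing
Cartan tensor C2-like.

Fix a point [x] and a direction [y], and write [T] for the Cartan tensor, [C]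
for its trace, [g] for the metric, [L] for the norm and [h = g - dL dL] for the
angular metric. The vector [B] kills [T], hence also [C]. Contracting the
semi-C-reducible expression of [T] with [B] leaves [r] times the symmetric
product of [h(B, _)] and [C]. Such a product vanishes only if a factor does, and
[h(B, _) = 0] forces [B] onto the line of [y], because [h] is degenerate only
along [y] (Euler's relation and positivity of [g]: [angular_metric_radical]). So
if [B] is not a multiple of [y], then [C = 0] and [T = 0], or [r = 0] and [t = 1];
in both cases [T] is C2-like ([semi_C_reducible_off_line]).

On the line of [B] this argument is empty and one passes to the limit. Off the
line [T] is a multiple of [C C C], so the indices in [T T T] can be
permuted; this identity is polynomial in [T] and extends by continuity to every
[y != 0] ([cartan_cube]). Contracting it with the inverse metric gives
[C^2 T_ijk = C_i C_j C_k] ([cube_contraction]). If [C^2 != 0] this is the claim.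
If [C^2 = 0], it gives [C_i ^ 3 = 0], so [C = 0], and [T = 0] by
semi-C-reducibility. *)

(** * Directional derivatives *)

Lemma derive_fiber {R : realType} {V1 V2 W : normedModType R} (f : V1 * V2 -> W)
    (x : V1) (v : V2) :
  'D_v (fun y => f (x, y)) = fun y => 'D_((0 : V1), v) f (x, y).
Proof.
apply/funext => y; rewrite /derive.
suff -> : (fun h => h^-1 *:
               (((fun z => f (x, z)) \o shift y) (h *: v) - f (x, y))) =
  fun h => h^-1 *: ((f \o shift (x, y)) (h *: ((0 : V1), v)) - f (x, y)) by [].
apply/funext => h /=; congr (_ *: (f _ - _)).
by apply: injective_projections => /=; rewrite ?scaler0 ?add0r.
Qed.

Lemma smooth_on_fiber {R : realType} {V1 V2 W : normedModType R}
    (U : set (V1 * V2)) (f : V1 * V2 -> W) (x : V1) :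
  smooth_on U f -> smooth_on [set y | U (x, y)] (fun y => f (x, y)).
Proof.
move=> fU vs y Uxy.
have -> : foldr (fun v g => 'D_v g) (fun y => f (x, y)) vs =
    fun y => foldr (fun v g => 'D_v g) f [seq ((0 : V1), v) | v <- vs] (x, y).
  by elim: vs => //= v vs ->; rewrite derive_fiber.
apply: (@differentiable_comp _ _ _ _ (fun y => (x, y))); last exact: fU.
exact: differentiable_pair.
Qed.

Section Coordinates.
Context {R : realType} {n : nat}.
Implicit Types (f L : 'rV[R]_n -> R^o) (u v y z : 'rV[R]_n).

Lemma derive_coord f y u : differentiable f y ->
  'D_u f y = \sum_i u 0 i * vderiv i f y.
Proof.
move=> df; rewrite deriveE// {1}[u]row_sum_delta linear_sum/=.
by apply: eq_bigr => i _; rewrite linearZ/= /vderiv deriveE.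
Qed.

Lemma near_neq0 y : y <> 0 -> \forall z \near y, z <> 0.
Proof.
move=> /eqP y0; have : \forall z \near y, id z != 0.
  exact: (cvgr_neq0 _ (@cvg_id _ (nbhs y)) y0).
by apply: filterS => z /eqP.
Qed.

(** [f] is affine along the ray, so its difference quotients in the direction of
the ray are constant near 0. *)
Lemma derive_ray f y (a b : R) : (forall s, 0 < s -> f (s *: y) = s * a + b) ->
  forall s, 0 < s -> 'D_y f (s *: y) = a.
Proof.
move=> fray s s0; rewrite /derive; apply: cvg_lim => //.
apply: cvg_near_cst.
have hs : \forall h \near (0 : R), 0 < h + s.
  have : (fun h : R => h + s) @ (0 : R) --> 0 + s.
    by apply: cvgD => //; exact: cvg_cst.
  by move=> /cvgr_gt; apply; rewrite add0r.
near=> h => /=.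
have h0 : h != 0 by near: h; exact: nbhs_dnbhs_neq.
rewrite -scalerDl !fray//; last by near: h; apply: nbhs_dnbhs.
by rewrite /GRing.scale/=; field.
Unshelve. all: by end_near.
Qed.

End Coordinates.

(** * Minkowski norms *)

Record minkowski_norm {R : realType} {n : nat} (L : 'rV[R]_n -> R^o) : Prop := {
  minkowski_smooth : smooth_on [set y | y <> 0] L;
  minkowski_homogeneous : forall (y : 'rV[R]_n) (s : R),
    0 < s -> L (s *: y) = s * L y;
  minkowski_metric_gt0 : forall y u : 'rV[R]_n, y <> 0 -> u <> 0 ->
    0 < (u *m metric L y *m u^T) 0 0
}.

Section Minkowski.
Context {R : realType} {n : nat} {L : 'rV[R]_n -> R^o}.
Hypothesis L_norm : minkowski_norm L.
Implicit Types (u v y z : 'rV[R]_n) (i j k : 'I_n).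

Lemma minkowski_diff y : y <> 0 -> differentiable L y.
Proof. exact: (minkowski_smooth _ L_norm [::]). Qed.

Lemma minkowski_diff1 y j : y <> 0 -> differentiable (vderiv j L : _ -> R^o) y.
Proof. exact: (minkowski_smooth _ L_norm [:: delta_mx 0 j]). Qed.

Lemma minkowski_diff2 y i j : y <> 0 ->
  differentiable (vderiv i (vderiv j L) : _ -> R^o) y.
Proof. exact: (minkowski_smooth _ L_norm [:: delta_mx 0 i; delta_mx 0 j]). Qed.

Lemma minkowski_diff3 y i j k : y <> 0 ->
  differentiable (vderiv k (vderiv i (vderiv j L)) : _ -> R^o) y.
Proof.
exact: (minkowski_smooth _ L_norm [:: delta_mx 0 k; delta_mx 0 i; delta_mx 0 j]).
Qed.

Lemma vderivD (f g : 'rV[R]_n -> R^o) k y :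
  differentiable f y -> differentiable g y ->
  vderiv k (fun z => f z + g z) y = vderiv k f y + vderiv k g y.
Proof.
move=> df dg; rewrite /vderiv.
by rewrite (deriveD (diff_derivable df) (diff_derivable dg)).
Qed.

Lemma vderivM (f g : 'rV[R]_n -> R^o) k y :
  differentiable f y -> differentiable g y ->
  vderiv k (fun z => f z * g z) y = f y * vderiv k g y + g y * vderiv k f y.
Proof.
move=> df dg; rewrite /vderiv.
by rewrite (deriveM (diff_derivable df) (diff_derivable dg)).
Qed.

Lemma near_eq_vderiv (f g : 'rV[R]_n -> R^o) k y : y <> 0 ->
  (forall z, z <> 0 -> f z = g z) -> vderiv k f y = vderiv k g y.
Proof.
move=> y0 fg; apply: near_eq_derive; have := near_neq0 _ y0.
by apply: filterS => z; exact: fg.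
Qed.

Lemma metricE y i j : y <> 0 ->
  metric L y i j =
  vderiv i L y * vderiv j L y + L y * vderiv i (vderiv j L) y.
Proof.
move=> y0; rewrite mxE.
have dLX z : z <> 0 ->
    vderiv j (fun z => L z ^+ 2) z = 2 * (L z * vderiv j L z).
  by move=> z0; rewrite vderivM; [ring|exact: minkowski_diff..].
have dE : vderiv i (vderiv j (fun z => L z ^+ 2)) y =
          2 * vderiv i (fun z => L z * vderiv j L z) y.
  rewrite (near_eq_vderiv _ _ i _ y0 dLX).
  rewrite /vderiv; apply: deriveZ; apply: diff_derivable.
  by apply: differentiableM; [exact: minkowski_diff|exact: minkowski_diff1].
rewrite dE (vderivM _ _ i _ (minkowski_diff _ y0) (minkowski_diff1 _ j y0)).
by field.
Qed.

Lemma angular_metricE y i j : y <> 0 ->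
  angular_metric L y i j = L y * vderiv i (vderiv j L) y.
Proof. by move=> y0; rewrite /angular_metric metricE// addrAC subrr add0r. Qed.

Lemma cartanE y i j k : y <> 0 ->
  cartan L y i j k =
  2^-1 * (vderiv i L y * vderiv k (vderiv j L) y +
          vderiv j L y * vderiv k (vderiv i L) y +
          L y * vderiv k (vderiv i (vderiv j L)) y +
          vderiv i (vderiv j L) y * vderiv k L y).
Proof.
move=> y0; rewrite /cartan; congr (_ * _).
rewrite (near_eq_vderiv _ _ k _ y0 (fun z => metricE z i j)).
have d0 := minkowski_diff _ y0; have d1 m := minkowski_diff1 _ m y0.
have d2 l m := minkowski_diff2 _ l m y0.
rewrite vderivD; [|exact: differentiableM..].
rewrite (vderivM _ _ k _ (d1 i) (d1 j)) (vderivM _ _ k _ d0 (d2 i j)).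
exact: addrA.
Qed.

Lemma cartan_continuous y i j k : y <> 0 ->
  cartan L z i j k @[z --> y] --> cartan L y i j k.
Proof.
move=> y0.
have d0 := minkowski_diff _ y0; have d1 m := minkowski_diff1 _ m y0.
have d2 l m := minkowski_diff2 _ l m y0.
have d3 l m p := minkowski_diff3 _ l m p y0.
pose f z : R^o := 2^-1 * (vderiv i L z * vderiv k (vderiv j L) z +
                          vderiv j L z * vderiv k (vderiv i L) z +
                          L z * vderiv k (vderiv i (vderiv j L)) z +
                          vderiv i (vderiv j L) z * vderiv k L z).
have df : differentiable f y.
  apply: (@differentiableM _ _ (cst 2^-1)); first exact: differentiable_cst.
  exact: (differentiableD (differentiableD (differentiableD
    (differentiableM (d1 i) (d2 k j)) (differentiableM (d1 j) (d2 k i)))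
    (differentiableM d0 (d3 i j k))) (differentiableM (d2 i j) (d1 k))).
have fE : \forall z \near y, f z = cartan L z i j k.
  have := near_neq0 _ y0; apply: filterS => z z0.
  by rewrite cartanE.
rewrite cartanE//; apply: cvg_trans (near_eq_cvg fE) _.
exact: (differentiable_continuous df).
Qed.

Lemma minkowski_derive_self y : y <> 0 -> \sum_i y 0 i * vderiv i L y = L y.
Proof.
move=> y0; rewrite -derive_coord; last exact: minkowski_diff.
rewrite -{1}[y]scale1r; apply: (derive_ray L y (L y) 0) => // s s0.
by rewrite addr0; exact: (minkowski_homogeneous _ L_norm).
Qed.

(** The angular metric is [L] times the Hessian of [L], and [L] is linear along
the ray through [y], so its second derivative in the direction [y] is zero. *)
Lemma angular_metric_self y : y <> 0 ->
  \sum_i \sum_j y 0 i * angular_metric L y i j * y 0 j = 0.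
Proof.
move=> y0.
have hess : \sum_j y 0 j * 'D_y (vderiv j L : _ -> R^o) y = 0.
  transitivity ('D_y ('D_y L) y).
    transitivity ('D_y (\sum_j (y 0 j \*: (vderiv j L : _ -> R^o))) y).
      rewrite derive_sum; last first.
          move=> j; apply: diff_derivable; apply: differentiableZ.
        exact: minkowski_diff1.
      apply: eq_bigr => j _; rewrite deriveZ//.
      by apply: diff_derivable; exact: minkowski_diff1.
    apply: near_eq_derive; have := near_neq0 _ y0; apply: filterS => z z0.
    by rewrite (derive_coord L)//; [rewrite fct_sumE|exact: minkowski_diff].
  have ray s : 0 < s -> 'D_y L (s *: y) = s * 0 + L y; last first.
    by rewrite -(derive_ray ('D_y L) y 0 (L y) ray 1 ltr01) scale1r.
  move=> s0; rewrite mulr0 add0r; apply: (derive_ray L y (L y) 0) => // r r0.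
  by rewrite addr0; exact: (minkowski_homogeneous _ L_norm).
rewrite exchange_big/=.
transitivity (L y * \sum_j y 0 j * 'D_y (vderiv j L : _ -> R^o) y).
  rewrite big_distrr/=; apply: eq_bigr => j _.
  rewrite (derive_coord (vderiv j L)); last exact: minkowski_diff1.
  rewrite !big_distrr/=; apply: eq_bigr => i _.
  by rewrite angular_metricE//; ring.
by rewrite hess mulr0.
Qed.

End Minkowski.

(** * The algebra of a single fibre *)

(** If [T] is a multiple of [w w w] for a covector [w], then the nine indices of
[T T T] may be permuted freely; the hypothesis [cube] is the instance which, on
contracting the pairs [lq], [mp] and [rs] with [G], produces [c c c]. *)
Lemma cube_contraction {K : comNzRingType} {I : finType} (T : I -> I -> I -> K)
    (G : I -> I -> K) (c : I -> K) :
  (forall i, c i = \sum_j \sum_k T i j k * G j k) ->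
  (forall i j k l m p q r s,
     T i j k * T l m p * T q r s = T i m p * T j r s * T k l q) ->
  forall i j k,
  (\sum_l c l * \sum_q G l q * c q) * T i j k = c i * c j * c k.
Proof.
move=> cE cube i j k.
have cE2 l : c l = \sum_(a : I * I) T l a.1 a.2 * G a.1 a.2.
  by rewrite cE pair_bigA.
have -> : \sum_l c l * (\sum_q G l q * c q) =
          \sum_(a : I * I) c a.1 * G a.1 a.2 * c a.2.
  rewrite -(pair_bigA _ (fun l q => c l * G l q * c q))/=; apply: eq_bigr => l _.
  by rewrite big_distrr/=; apply: eq_bigr => q _; rewrite mulrA.
transitivity (\sum_(a : I * I) \sum_(b : I * I) \sum_(d : I * I)
    T i b.1 b.2 * T j d.1 d.2 * T k a.1 a.2 *
      (G a.1 a.2 * G b.1 b.2 * G d.1 d.2)).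
  rewrite big_distrl/=; apply: eq_bigr => a _.
  rewrite (cE2 a.1) (cE2 a.2) [X in X * T i j k]mulrAC big_distrlr/= -mulrA big_distrl/=.
  apply: eq_bigr => b _; rewrite big_distrl/=; apply: eq_bigr => d _.
  by rewrite -(cube i j k a.1 b.1 b.2 a.2); ring.
rewrite mulrC (cE2 k) big_distrl/=; apply: eq_bigr => a _.
rewrite (cE2 i) (cE2 j) big_distrlr/= big_distrr/=; apply: eq_bigr => b _.
rewrite big_distrr/=; apply: eq_bigr => d _.
by ring.
Qed.

Lemma sym_product_eq0 {K : idomainType} {I : Type} (b b' c : I -> K) :
  (forall j k, b j * c k + b' k * c j = 0) -> forall k, c k != 0 ->
  forall j, b j + b' j = 0.
Proof.
move=> bc k ck j; have [cj0|cj] := eqVneq (c j) 0.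
  have /eqP := bc j k; rewrite cj0 mulr0 addr0 mulf_eq0 (negPf ck) orbF => /eqP ->.
  by have /eqP := bc k j; rewrite cj0 mulr0 !add0r mulf_eq0 (negPf ck) orbF => /eqP ->.
by have /eqP := bc j j; rewrite -mulrDl mulf_eq0 (negPf cj) orbF => /eqP.
Qed.

(** The semi-C-reducible and C2-like expressions agree where [C = 0]. *)
Lemma cubic_vanish {K : pzRingType} (a b d p q s : K) :
  a * (p * 0 + q * 0 + s * 0) + b * 0 * 0 * 0 = d * 0 * 0 * 0.
Proof. by rewrite !mulr0 !addr0 mulr0. Qed.

Definition pairing {K : pzRingType} {n : nat} (H : 'I_n -> 'I_n -> K)
    (u v : 'rV[K]_n) : K :=
  \sum_i \sum_j u 0 i * H i j * v 0 j.

Section Pairing.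
Context {K : numFieldType} {n : nat}.
Implicit Types (H : 'I_n -> 'I_n -> K) (B u v w : 'rV[K]_n).

Lemma pairingBZl H a u v w : pairing H (u - a *: v) w =
  pairing H u w - a * pairing H v w.
Proof.
rewrite /pairing big_distrr -sumrB/=; apply: eq_bigr => i _.
rewrite big_distrr -sumrB/=; apply: eq_bigr => j _.
by rewrite !mxE; ring.
Qed.

Lemma pairingBZr H a u v w : pairing H w (u - a *: v) =
  pairing H w u - a * pairing H w v.
Proof.
rewrite /pairing big_distrr -sumrB/=; apply: eq_bigr => i _.
rewrite big_distrr -sumrB/=; apply: eq_bigr => j _.
by rewrite !mxE; ring.
Qed.

(** The hypothesis puts [B] in the radical of the symmetric part of [H], and that
part alone determines the quadratic form; so adding multiples of [B] does not
change it. *)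
Lemma pairing_radical H B :
  (forall j, \sum_i B 0 i * H i j + \sum_i B 0 i * H j i = 0) ->
  forall a u, pairing H (B - a *: u) (B - a *: u) = a ^+ 2 * pairing H u u.
Proof.
move=> radB a u.
have rad v : pairing H B v + pairing H v B = 0.
  rewrite /pairing exchange_big/= -big_split/=; apply: big1 => j _.
  transitivity ((\sum_i B 0 i * H i j + \sum_i B 0 i * H j i) * v 0 j).
    rewrite mulrDl !big_distrl/=; congr (_ + _); apply: eq_bigr => i _.
    by ring.
  by rewrite radB mul0r.
have radu : pairing H B u = - pairing H u B by apply/eqP; rewrite -addr_eq0 rad.
have BB0 : pairing H B B = 0.
  by apply/eqP; have /eqP := rad B; rewrite -mulr2n mulrn_eq0.
by rewrite !(pairingBZl, pairingBZr) BB0 radu; ring.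
Qed.

End Pairing.

Lemma exists_not_colinear {K : fieldType} {n : nat} (y : 'rV[K]_n) :
  (2 <= n)%N ->
  exists v : 'rV[K]_n, forall a, v <> a *: y.
Proof.
case: n y => [|[|n]]// y _; apply: contrapT => /forallNP nv.
pose i0 : 'I_n.+2 := ord0; pose i1 : 'I_n.+2 := ord_max.
have e m : exists a, delta_mx 0 m = a *: y.
  by apply: contrapT => /forallNP; exact: nv.
have [[a ea] [b eb]] := (e i0, e i1).
have i10 : (i1 == i0) = false by [].
have := congr1 (fun u : 'rV_n.+2 => u 0 i0) ea.
have := congr1 (fun u : 'rV_n.+2 => u 0 i1) ea.
have := congr1 (fun u : 'rV_n.+2 => u 0 i1) eb.
rewrite !mxE !eqxx i10/= => b1 /esym/eqP; rewrite mulf_eq0 => /orP[/eqP ->|/eqP y1 _].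
  by move=> /eqP; rewrite mul0r oner_eq0.
by move/eqP: b1; rewrite y1 mulr0 oner_eq0.
Qed.

Section Fiber.
Context {R : realType} {n : nat} {L : 'rV[R]_n -> R^o}.
Hypothesis L_norm : minkowski_norm L.
Implicit Types (B u v y z : 'rV[R]_n) (i j k : 'I_n).

Lemma metric_pairing y u :
  (u *m metric L y *m u^T) 0 0 =
  pairing (angular_metric L y) u u + (\sum_i u 0 i * vderiv i L y) ^+ 2.
Proof.
rewrite mxE expr2 big_distrlr/= /pairing -big_split/=.
under [RHS]eq_bigr do rewrite -big_split/=.
rewrite exchange_big/=; apply: eq_bigr => j _.
rewrite !mxE big_distrl/=; apply: eq_bigr => i _.
by rewrite /angular_metric; ring.
Qed.

(** Removing from [B] its component along [y] gives a vector [u] with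
[dL(u) = 0]. Since [B] is in the radical and [h(y, y) = 0], also [h(u, u) = 0];
hence [g(u, u) = h(u, u) + dL(u)^2 = 0], and [u = 0]. *)
Lemma angular_metric_radical B y : y <> 0 ->
  (forall j, \sum_i B 0 i * angular_metric L y i j +
             \sum_i B 0 i * angular_metric L y j i = 0) ->
  exists a, B = a *: y.
Proof.
move=> y0 radB.
have yy0 : pairing (angular_metric L y) y y = 0 by exact: angular_metric_self.
have Ly0 : L y != 0.
  apply/eqP => Ly; have := minkowski_metric_gt0 _ L_norm _ _ y0 y0.
  by rewrite metric_pairing yy0 minkowski_derive_self// Ly add0r expr2 mul0r ltxx.
pose a := (\sum_i B 0 i * vderiv i L y) / L y.
exists a; apply/eqP; rewrite -subr_eq0; apply/negPn/negP => /eqP u0.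
have := minkowski_metric_gt0 _ L_norm _ _ y0 u0.
rewrite metric_pairing pairing_radical// yy0 mulr0 add0r.
suff -> : \sum_i (B - a *: y) 0 i * vderiv i L y = 0 by rewrite expr2 mul0r ltxx.
transitivity (\sum_i B 0 i * vderiv i L y - a * \sum_i y 0 i * vderiv i L y).
  by rewrite big_distrr -sumrB/=; apply: eq_bigr => i _; rewrite !mxE; ring.
by rewrite minkowski_derive_self// /a divfK// subrr.
Qed.

(** [B] annihilates the Cartan tensor and so its trace [C]; contracting the
semi-C-reducible form with [B] therefore leaves [r (b_j C_k + b'_k C_j) = 0],
where [b] and [b'] contract [h] with [B] on the left and on the right. If
[r != 0] and [C != 0] then [b + b' = 0], which places [B] on the line of [y].
So [r = 0] and [t = 1], or [C = 0] and both sides vanish. *)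
Lemma semi_C_reducible_off_line (r t : R) B y : y <> 0 ->
  (forall a, B <> a *: y) ->
  (forall i j, \sum_h B 0 h * cartan L y h i j = 0) ->
  r + t = 1 ->
  (forall i j k, cartan L y i j k =
     r / (n + 1)%:R *
       (angular_metric L y i j * mean_cartan L y k +
        angular_metric L y k i * mean_cartan L y j +
        angular_metric L y j k * mean_cartan L y i) +
     t / mean_cartan_sq L y *
       mean_cartan L y i * mean_cartan L y j * mean_cartan L y k) ->
  forall i j k, cartan L y i j k =
    1 / mean_cartan_sq L y *
      mean_cartan L y i * mean_cartan L y j * mean_cartan L y k.
Proof.
move=> y0 By BT rt TE i j k.
set h := angular_metric L y in TE; set c := mean_cartan L y in TE *.
have Bc : \sum_i B 0 i * c i = 0.
  transitivity (\sum_j \sum_k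
      (\sum_i B 0 i * cartan L y i j k) * invmx (metric L y) j k).
    under eq_bigr do rewrite big_distrr/=.
    rewrite exchange_big/=; apply: eq_bigr => p _.
    under eq_bigr do rewrite big_distrr/=.
    rewrite exchange_big/=; apply: eq_bigr => q _.
    by rewrite big_distrl/=; apply: eq_bigr => m _; rewrite mulrA.
  by apply: big1 => p _; apply: big1 => q _; rewrite BT mul0r.
(* Otherwise the distributivity rewrites below reach the sums inside [c]. *)
clearbody c.
have [r0|r0] := eqVneq r 0.
  by rewrite TE r0 mul0r mul0r add0r -rt r0 add0r.
suff c0 m : c m = 0 by rewrite TE (c0 i) (c0 j) (c0 k); exact: cubic_vanish.
apply/eqP/negPn/negP => cm.
pose b p := \sum_i B 0 i * h i p; pose b' p := \sum_i B 0 i * h p i.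
have bc p q : b p * c q + b' q * c p = 0.
  have : r / (n + 1)%:R * (b p * c q + b' q * c p) = 0.
    rewrite -(BT p q).
    transitivity (r / (n + 1)%:R * (b p * c q + b' q * c p) +
      (r / (n + 1)%:R * h p q + t / mean_cartan_sq L y * c p * c q) *
        \sum_i B 0 i * c i).
      by rewrite Bc mulr0 addr0.
    rewrite /b /b' !big_distrl -big_split/= !big_distrr/= -big_split/=.
    apply: eq_bigr => l _; rewrite TE.
    move: (r / _) (t / _) (h l p) (h q l) (h p q) (c l) (c p) (c q) (B 0 l).
    by move=> *; ring.
  move/eqP; rewrite !mulf_eq0 (negPf r0) invr_eq0 pnatr_eq0 addn1/=.
  by move/eqP.
by have [a Ba] := angular_metric_radical _ _ y0 (sym_product_eq0 _ _ _ bc _ cm);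
  exact: (By a).
Qed.

(** On the line of [B], contraction with [B] carries no information about the
Cartan tensor, and the values there come from continuity. Division by [C^2] does
not pass to the limit where [C = 0], so what is extended is a polynomial
consequence of C2-likeness. *)
Lemma cartan_cube B : (2 <= n)%N -> B <> 0 ->
  (forall y, y <> 0 -> (forall a, B <> a *: y) ->
   forall i j k, cartan L y i j k =
     1 / mean_cartan_sq L y *
       mean_cartan L y i * mean_cartan L y j * mean_cartan L y k) ->
  forall y, y <> 0 -> forall i j k l m p q r s,
  cartan L y i j k * cartan L y l m p * cartan L y q r s =
  cartan L y i m p * cartan L y j r s * cartan L y k l q.
Proof.
move=> n2 B0 C2 y y0 i j k l m p q r s.
have off z : z <> 0 -> (forall a, B <> a *: z) ->
    cartan L z i j k * cartan L z l m p * cartan L z q r s =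
    cartan L z i m p * cartan L z j r s * cartan L z k l q.
  move=> z0 Bz; rewrite !(C2 z z0 Bz).
  by move: (1 / _) (mean_cartan L z) => e c; ring.
have [[b Bb]|/forallNP nB] := pselect (exists b, B = b *: y); last exact: off.
(* [y + e v] is off the line of [y], which is that of [B], for every [e != 0]. *)
have [v vy] := exists_not_colinear y n2.
pose phi z : R := cartan L z i j k * cartan L z l m p * cartan L z q r s -
  cartan L z i m p * cartan L z j r s * cartan L z k l q.
have phi_y : phi z @[z --> y] --> phi y.
  have cT a b c := cartan_continuous L_norm y a b c y0.
  exact: (cvgB (cvgM (cvgM (cT i j k) (cT l m p)) (cT q r s))
               (cvgM (cvgM (cT i m p) (cT j r s)) (cT k l q))).
have line_y : y + e *: v @[e --> (0 : R)^'] --> y.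
  rewrite -[X in _ --> X]addr0 -(scale0r v).
  apply: cvgD; first exact: cvg_cst.
  by apply: cvgZr_tmp; exact: nbhs_dnbhs.
have phi0 : phi (y + e *: v) @[e --> (0 : R)^'] --> (0 : R).
  apply: cvg_near_cst; near=> e.
  have e0 : e != 0 by near: e; exact: nbhs_dnbhs_neq.
  have ve a : y + e *: v = a *: y -> False.
    move=> E; apply: (vy ((a - 1) / e)); apply: (scalerI e0).
    by rewrite scalerA mulrC divfK// scalerBl scale1r -E addrC addKr.
  apply/eqP; rewrite /phi subr_eq0; apply/eqP/off => [E|a E].
    by apply: (ve 0); rewrite scale0r.
  have [a0|a0] := eqVneq a 0; first by apply: B0; rewrite E a0 scale0r.
  apply: (ve (b / a)); apply: (scalerI a0).
  by rewrite scalerA mulrC divfK// -Bb E.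
apply/eqP; rewrite -subr_eq0; apply/eqP.
exact: (cvg_unique _ (cvg_comp _ _ line_y phi_y) phi0).
Unshelve. all: by end_near.
Qed.

End Fiber.

(** * Finsler manifolds *)

Section Coord.
Context {R : realType} {n : nat} {M : manifold R n}.
Implicit Types (F : tangent_bundle M -> R) (x y : 'rV[R]_n).

Lemma chart_inv_dom (a : atlas_index M) x :
  chart_cod (atlas a) x -> chart_dom (atlas a) (chart_inv (atlas a) x).
Proof. by move=> [p pa <-]; rewrite chart_mapK ?inE. Qed.

Lemma tangent_of_coordZ (a : atlas_index M) x y (s : R) :
  chart_cod (atlas a) x ->
  tangent_of_coord a x (s *: y) = s *: tangent_of_coord a x y.
Proof.
move=> xa; apply: (tangent_inj (chart_inv_dom _ _ xa)).
have -> : (s *: tangent_of_coord a x y) a = s *: tangent_of_coord a x y a by [].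
by rewrite !tangent_of_coordE.
Qed.

Lemma tangent_of_coord_neq0 (a : atlas_index M) x y : chart_cod (atlas a) x ->
  y <> 0 -> tangent_of_coord a x y <> 0.
Proof. by move=> xa y0 E; apply: y0; rewrite -(tangent_of_coordE y xa) E. Qed.

Lemma in_coord_minkowski F (a : atlas_index M) x : finsler_structure F ->
  chart_cod (atlas a) x -> minkowski_norm (in_coord F a x).
Proof.
move=> FF xa; split.
- move=> vs y y0.
  exact: (smooth_on_fiber _ _ x (@finsler_smooth _ _ _ _ FF a) vs y (conj xa y0)).
- move=> y s s0; rewrite /in_coord tangent_of_coordZ//.
  exact: finsler_homogeneous.
- by move=> y u y0; exact: (finsler_metric_gt0 FF xa y0).
Qed.

End Coord.

Theorem theorem3p12 (R : realType) (n : nat) (M : manifold R n)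
    (F : tangent_bundle M -> R)
    (finsler_F : finsler_structure F)
    (semiC_F : semi_C_reducible F)
    (SC_F : SC_condition F) :
  riemannian F \/ C2_like F.
Proof.
right; have [n3 [r [t [rt TE]]]] := semiC_F; have [B [_ B0 BT]] := SC_F.
have n2 : (2 <= n)%N := ltnW n3.
split => // a x y xa y0 L C i j k.
have L_norm : minkowski_norm L := in_coord_minkowski _ _ _ finsler_F xa.
have Bx0 : B (chart_inv (atlas a) x) a <> 0.
  move=> Bx; apply: (B0 (chart_inv (atlas a) x)).
  exact: (tangent_inj (chart_inv_dom _ _ xa)).
have cube := cartan_cube L_norm _ n2 Bx0 (fun z z0 Bz =>
  semi_C_reducible_off_line L_norm _ _ _ z z0 Bz (BT a x z xa z0)
    (rt _ _ (tangent_of_coord_neq0 _ _ _ xa z0)) (TE a x z xa z0)) y y0.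
have C2T := cube_contraction (cartan L y) (invmx (metric L y)) C (fun=> erefl) cube.
have [C20|C20] := eqVneq (mean_cartan_sq L y) 0; last first.
  apply: (mulfI C20); rewrite mul1r -!mulrA mulVKf// mulrA.
  exact: C2T.
(* Here [C_m ^ 3 = C^2 C_mmm = 0]. *)
have C0 m : C m = 0.
  have := C2T m m m; rewrite -/(mean_cartan_sq L y) C20 mul0r => /esym/eqP.
  by rewrite !mulf_eq0 => /orP[/orP[]|] /eqP.
have := TE a x y xa y0 i j k; rewrite -/L -/C (C0 i) (C0 j) (C0 k) => ->.
exact: cubic_vanish.
Qed.
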